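(* The deterministic switching family $\mathcal H=\{A_\pi:\pi\in\Theta\}$ of Q-value iteration satisfies \[ \rho(\mathcal H)=\gamma, \] where $\rho$ denotes the joint spectral radius.
   Context: Setting: a finite discounted Markov decision process with finite nonempty state space $\mathcal S$, finite nonempty action space $\mathcal A$, transition probabilities $P(s'\mid s,a)$ and discount factor $\gamma\in(0,1)$. Put $n:=|\mathcal S||\mathcal A|$; vectors in $\mathbb R^n$ are indexed by pairs $(s,a)$. $\Theta$ denotes the set of deterministic policies $\pi:\mathcal S\to\mathcal A$. For $\pi\in\Theta$, $A_\pi\in\mathbb R^{n\times n}$ has entries $A_\pi((s,a),(s',a')):=\gamma P(s'\mid s,a)$ if $a'=\pi(s')$ and $0$ otherwise. The joint spectral radius of a bounded set $\mathcal H$ of real square matrices is $\rho(\mathcal H):=\lim_{k\to\infty}\sup_{A_1,\dots,A_k\in\mathcal H}\|A_k\cdots A_1\|^{1/k}$ for any submultiplicative matrix norm (the value does not depend on the norm). *)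

(* Defs.v *)
(* MathComp-Analysis; the real numbers are an arbitrary realType. *)
From HB Require Import structures.
From mathcomp Require Import all_boot all_order all_algebra.
From mathcomp Require Import all_classical all_reals all_analysis.
Set Implicit Arguments.
Unset Strict Implicit.
Unset Printing Implicit Defensive.
Import Order.TTheory GRing.Theory Num.Theory.
Import numFieldNormedType.Exports.
Local Open Scope classical_set_scope.
Local Open Scope ring_scope.

Record submultiplicative_norm (R : realType) (n : nat) (N : 'M[R]_n -> R) :
    Prop := SubmultiplicativeNorm {
  smn_definite : forall M, N M = 0 -> M = 0 ;
  smn_triangle : forall M M', N (M + M') <= N M + N M' ;
  smn_homogeneous : forall c M, N (c *: M) = `|c| * N M ;
  smn_submultiplicative : forall M M', N (M *m M') <= N M * N M'
}.

(* The factor B i stands for A_(i+1), so that the product below is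
   A_k *m ... *m A_1. *)
Definition rev_product (R : realType) (n k : nat) (B : 'I_k -> 'M[R]_n) :
    'M[R]_n :=
  \big[mulmx/1%:M]_(i < k) B (rev_ord i).

(* [sup] is the genuine supremum when H is nonempty and bounded. The term
   k = 0 has exponent 0^-1 = 0 and is irrelevant for the limit. *)
Definition jsr_seq (R : realType) (n : nat) (N : 'M[R]_n -> R)
    (H : set 'M[R]_n) : R^nat :=
  fun k => sup [set r | exists B : 'I_k -> 'M[R]_n,
                  (forall i, H (B i)) /\ r = N (rev_product B) `^ (k%:R^-1)].

Definition joint_spectral_radius (R : realType) (n : nat) (N : 'M[R]_n -> R)
    (H : set 'M[R]_n) : R :=
  limn (jsr_seq N H).

(* P s a s' is the probability P(s' | s, a). *)
Definition transition_kernel (R : realType) (S A : finType)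
    (P : S -> A -> S -> R) : Prop :=
  (forall s a s', 0 <= P s a s') /\ (forall s a, \sum_(s' : S) P s a s' = 1).

(* Rows and columns are indexed by the pairs (s, a) through the enumeration of
   S * A, a type with #|S| * #|A| elements; {ffun S -> A} is the type of
   deterministic policies. *)
Definition policy_matrix (R : realType) (S A : finType) (P : S -> A -> S -> R)
    (gamma : R) (pi : {ffun S -> A}) : 'M[R]_#|{: S * A}| :=
  \matrix_(i, j)
    if (enum_val j).2 == pi (enum_val j).1
    then gamma * P (enum_val i).1 (enum_val i).2 (enum_val j).1
    else 0.

Definition switching_family (R : realType) (S A : finType)
    (P : S -> A -> S -> R) (gamma : R) : set 'M[R]_#|{: S * A}| :=
  range (policy_matrix P gamma).

(* Main.v *)
Require Import Defs.
From HB Require Import structures.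
From mathcomp Require Import all_boot all_order all_algebra.
From mathcomp Require Import all_classical all_reals all_analysis.
Import Order.TTheory GRing.Theory Num.Theory.
Import numFieldNormedType.Exports.
Local Open Scope classical_set_scope.
Local Open Scope ring_scope.

(** Each [policy_matrix] is [gamma] times a row-stochastic matrix: the entries
    are nonnegative and every row sums to [gamma]. A product [M] of [k] such
    matrices is again nonnegative, with all row sums [gamma ^+ k]. This traps
    [N M] between constant multiples of [gamma ^+ k], whatever the product:

    - from below ([row_sums_norm_ge]): if [J] is the all-ones matrix, then
      [M *m J = gamma ^+ k *: J], so submultiplicativity gives
      [gamma ^+ k * N J <= N M * N J], and [N J > 0] cancels;
    - from above ([row_sums_norm_le]): every entry of [M] is at most its row
      sum, so the triangle inequality on the canonical basis gives
      [N M <= gamma ^+ k * C], where [C] depends on [N] alone.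

    Taking [k]-th roots, the [k]-th term of the sequence lies between [gamma]
    and [gamma * C `^ k^-1]. Since [C `^ k^-1] tends to [1], the sequence
    converges to [gamma] ([jsr_row_sums]). *)

Definition basis_norm {R : realType} {n : nat} (N : 'M[R]_n -> R) : R :=
  \sum_i \sum_j N (delta_mx i j).

(** Written as the equation [M *m J = r *: J] with the all-ones matrix [J],
    row sums multiply along products by associativity. A square [J], rather
    than an all-ones column, lets a norm on square matrices be applied to both
    sides. *)
Definition row_sums {R : realType} {n : nat} (r : R) (M : 'M[R]_n) : Prop :=
  (forall i j, 0 <= M i j) /\ M *m const_mx 1 = r *: const_mx 1 :> 'M[R]_n.

Section Norm.
Context {R : realType} {n : nat} {N : 'M[R]_n -> R}
  (hN : submultiplicative_norm N).

Lemma smn0 : N 0 = 0.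
Proof. by rewrite -(scale0r (0 : 'M[R]_n)) (smn_homogeneous hN) normr0 mul0r. Qed.

Lemma smn_ge0 M : 0 <= N M.
Proof.
have := smn_triangle hN M (-1 *: M).
rewrite (smn_homogeneous hN) normrN1 mul1r scaleN1r subrr smn0.
by rewrite -mulr2n pmulrn_lge0.
Qed.

Lemma smn_sum (I : finType) (F : I -> 'M[R]_n) :
  N (\sum_i F i) <= \sum_i N (F i).
Proof.
elim/big_ind2: _ => [|x M y M' leM leM'|//]; first by rewrite smn0.
exact: le_trans (smn_triangle hN _ _) (lerD leM leM').
Qed.

Lemma row_sums_norm_ge (r : R) (M : 'M[R]_n) :
  (0 < n)%N -> 0 <= r -> row_sums r M -> r <= N M.
Proof.
move=> n_gt0 r0 [_ MJ]; set J : 'M[R]_n := const_mx 1.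
have NJ : 0 < N J.
  rewrite lt_neqAle smn_ge0 andbT eq_sym; apply/eqP => /(smn_definite hN).
  move=> /matrixP /(_ (Ordinal n_gt0) (Ordinal n_gt0)) /eqP.
  by rewrite !mxE oner_eq0.
rewrite -(ler_pM2r NJ).
by rewrite -{1}(ger0_norm r0) -(smn_homogeneous hN) -MJ (smn_submultiplicative hN).
Qed.

Lemma row_sums_norm_le (r : R) (M : 'M[R]_n) :
  row_sums r M -> N M <= r * basis_norm N.
Proof.
move=> [M0 MJ].
have Mr i j : M i j <= r.
  move/matrixP/(_ i j): MJ; rewrite !mxE mulr1 (bigD1 j) //= mxE mulr1 => <-.
  by rewrite lerDl sumr_ge0 // => k _; rewrite mxE mulr1.
rewrite {1}(matrix_sum_delta M) mulr_sumr.
apply: le_trans (smn_sum _ _) _; apply: ler_sum => i _.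
rewrite mulr_sumr; apply: le_trans (smn_sum _ _) _; apply: ler_sum => j _.
by rewrite (smn_homogeneous hN) ger0_norm // ler_wpM2r // smn_ge0.
Qed.

End Norm.

Lemma row_sums_prod (R : realType) (n k : nat) (r : R) (F : 'I_k -> 'M[R]_n) :
  (forall i, row_sums r (F i)) ->
  row_sums (r ^+ k) (\big[mulmx/1%:M]_(i < k) F i).
Proof.
elim: k F => [|k IHk] F HF.
  rewrite big_ord0 expr0 /row_sums mul1mx scale1r; split=> // i j.
  by rewrite mxE ler0n.
have [P0 PJ] := IHk (fun i => F (lift ord0 i)) (fun i => HF _).
have [F0 FJ] := HF ord0.
rewrite big_ord_recl; split=> [i j|].
  by rewrite mxE sumr_ge0 // => l _; rewrite mulr_ge0.
by rewrite -mulmxA PJ -scalemxAr FJ scalerA -exprSr.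
Qed.

(** A positive constant factor does not affect the exponential growth rate. *)
Lemma cvg_powR_invn (R : realType) (C : R) : 0 < C ->
  C `^ (k%:R^-1) @[k --> \oo] --> (1 : R).
Proof.
move=> C0.
have -> : (fun k => C `^ (k%:R^-1)) = (fun k : nat => expR (k%:R^-1 * ln C)).
  by apply/funext => k; rewrite /powR gt_eqF.
suff : expR (k%:R^-1 * ln C) @[k --> \oo] --> expR (0 * ln C).
  by rewrite mul0r expR0.
apply: continuous_cvg; first exact: continuous_expR.
apply: cvgMr_tmp.
apply: (gtr0_cvgV0 _).2; last exact: cvgr_idn.
by near=> k; rewrite ltr0n; near: k; exists 1%N.
Unshelve. all: by end_near. Qed.

(** Only the common row sum matters: the bounds on norms are uniform over all
    products of length [k], so they pass to the supremum, for any nonempty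
    family, finite or not. *)
Lemma jsr_row_sums (R : realType) (n : nat) (N : 'M[R]_n -> R)
    (H : set 'M[R]_n) (r : R) :
  submultiplicative_norm N -> (0 < n)%N -> 0 < r -> H !=set0 ->
  (forall M, H M -> row_sums r M) -> jsr_seq N H @ \oo --> r.
Proof.
move=> hN n_gt0 r0 [M0 HM0] Hr; set C : R := basis_norm N.
have C0 : 0 < C.
  rewrite -(pmulr_rgt0 _ r0); apply: (lt_le_trans r0).
  have M0r := Hr _ HM0.
  exact: le_trans (row_sums_norm_ge hN _ _ n_gt0 (ltW r0) M0r)
                  (row_sums_norm_le hN _ _ M0r).
apply: (@squeeze_cvgr _ _ _ _ (cst r) (fun k => r * C `^ (k%:R^-1))).
- near=> k.
  have k0 : (0 < k)%N by near: k; exists 1%N.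
  have rootK : (r ^+ k) `^ (k%:R^-1) = r.
    by rewrite -powR_mulrn ?ltW // -powRrM divff ?powRr1 ?ltW // pnatr_eq0 -lt0n.
  have kV0 : 0 <= k%:R^-1 :> R by rewrite invr_ge0 ler0n.
  have rk0 : 0 <= r ^+ k by rewrite exprn_ge0 ?ltW.
  rewrite /jsr_seq; set E := [set _ | _].
  have Ege x : E x -> r <= x.
    move=> [B [HB ->]]; rewrite -{1}rootK.
    apply: ge0_ler_powR; rewrite ?nnegrE ?(smn_ge0 hN) //.
    apply: (row_sums_norm_ge hN _ _ n_gt0 rk0).
    by apply: row_sums_prod => i; exact: Hr.
  (* This bound also makes the supremum genuine rather than a default value. *)
  have Ele : ubound E (r * C `^ (k%:R^-1)).
    move=> x [B [HB ->]]; rewrite -{1}rootK -powRM ?(ltW C0) //.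
    apply: ge0_ler_powR; rewrite ?nnegrE ?(smn_ge0 hN) ?mulr_ge0 ?(ltW C0) //.
    apply: (row_sums_norm_le hN).
    by apply: row_sums_prod => i; exact: Hr.
  have [x Ex] : E !=set0.
    by exists (N (rev_product (fun _ : 'I_k => M0)) `^ (k%:R^-1)), (fun=> M0).
  rewrite ge_sup ?andbT //; last by exists x.
  by apply: le_trans (Ege _ Ex) _; apply: ub_le_sup => //; exists (r * C `^ (k%:R^-1)).
- exact: cvg_cst.
- by rewrite -[X in _ --> X]mulr1; apply: cvgMl_tmp; exact: cvg_powR_invn.
Unshelve. all: by end_near. Qed.

(** For each next state [s'], exactly one column [(s', a')] carries the mass
    [gamma * P s a s'], namely the one with [a' = pi s']; the policy decides
    where the mass sits in a row but not how much there is. *)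
Lemma policy_matrix_row_sums (R : realType) (S A : finType)
    (P : S -> A -> S -> R) (gamma : R) (pi : {ffun S -> A}) :
  transition_kernel P -> 0 <= gamma ->
  row_sums gamma (policy_matrix P gamma pi).
Proof.
move=> [P0 P1] g0; split=> [i j|].
  by rewrite mxE; case: ifP => // _; rewrite mulr_ge0.
apply/matrixP => i j; rewrite !mxE mulr1.
pose f (s' : S) (a' : A) := if a' == pi s'
  then gamma * P (enum_val i).1 (enum_val i).2 s' else 0.
transitivity (\sum_(p : S * A) f p.1 p.2).
  rewrite [RHS](reindex (@enum_val _ {: S * A})) /=; last first.
    exact: onW_bij (enum_val_bij _).
  by apply: eq_bigr => l _; rewrite !mxE mulr1.
rewrite -(pair_bigA _ f) /= -[RHS]mulr1 -(P1 (enum_val i).1 (enum_val i).2).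
rewrite mulr_sumr; apply: eq_bigr => s' _.
by rewrite /f -big_mkcond big_pred1_eq.
Qed.

Theorem proposition1 (R : realType) (S A : finType)
    (hS : (0 < #|S|)%N) (hA : (0 < #|A|)%N)
    (P : S -> A -> S -> R) (hP : transition_kernel P)
    (gamma : R) (hgamma0 : 0 < gamma) (hgamma1 : gamma < 1)
    (N : 'M[R]_#|{: S * A}| -> R) (hN : submultiplicative_norm N) :
  cvgn (jsr_seq N (switching_family P gamma)) /\
  joint_spectral_radius N (switching_family P gamma) = gamma.
Proof.
have cvg_gamma : jsr_seq N (switching_family P gamma) @ \oo --> gamma.
  have [a _] := card_gt0P hA.
  apply: jsr_row_sums => //.
  - by rewrite card_prod muln_gt0 hS.
  - by exists (policy_matrix P gamma [ffun=> a]), [ffun=> a].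
  - by move=> _ [pi _ <-]; exact: policy_matrix_row_sums (ltW hgamma0).
split; first by apply/cvg_ex; exists gamma.
exact/cvg_lim.
Qed.
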